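(* Let $(V,\omega)$ be an $n$-dimensional multisymplectic vector space of degree $k+1$. Then: (1) For $1\le l\le n$, each subspace of $V$ of dimension $l$ is Type-II $l$-isotropic. (2) If $\omega$ is $r$-nondegenerate, where $1\le r\le k$, and if $W$ is a Type-II $r$-isotropic subspace of $V$, then $\operatorname{codim} W\geq k+1-r$. (3) If $k+1=n$ (that is, $\omega$ is a volume form for $V$), then every nonzero subspace $W$ of $V$ is Type-II $l$-Lagrangian with $l=\dim W$, and, moreover, $W_{II}^{\perp,l'}=\{0\}$ for all $1\le l'<l$.
   Context: Vector spaces are real. A multisymplectic vector space of degree $k+1$ (with $k\ge 1$) is a pair $(V,\omega)$ with $V$ an $n$-dimensional vector space and $\omega$ an exterior $(k+1)$-form on $V$ such that $v\lrcorner\omega=0$ iff $v=0$, for $v\in V$. Contraction: $(v_1\wedge\cdots\wedge v_r)\lrcorner\omega=\omega(v_1,\ldots,v_r,\cdot,\ldots,\cdot)$, a form of degree $k+1-r$, understood to be $0$ if $r>k+1$. For a subspace $W\subseteq V$, $G^lW=\{w_1\wedge\cdots\wedge w_l:w_i\in W\}$ is the set of decomposable $l$-multivectors (it always contains $0$). $\omega$ is $r$-nondegenerate if for all $v_1\wedge\cdots\wedge v_r\in G^rV$: $(v_1\wedge\cdots\wedge v_r)\lrcorner\omega=0$ if and only if $v_1\wedge\cdots\wedge v_r=0$. The Type-II $l$-th orthogonal complement of $W$, $1\le l\le n$, is $W_{II}^{\perp,l}=\{v_1\wedge\cdots\wedge v_l\in G^lV:(v_1\wedge\cdots\wedge v_l\wedge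 w)\lrcorner\omega=0\text{ for all }w\in W\}$. $W$ is Type-II $l$-isotropic if $G^lW\subseteq W_{II}^{\perp,l}$, and Type-II $l$-Lagrangian if $G^lW=W_{II}^{\perp,l}$. *)

(* Defs.v *)
From HB Require Import structures.
From mathcomp Require Import all_boot all_order all_algebra.
From mathcomp Require Import all_classical all_reals.

Set Implicit Arguments.
Unset Strict Implicit.
Unset Printing Implicit Defensive.

Import Order.TTheory GRing.Theory Num.Theory.
Local Open Scope ring_scope.
Local Open Scope classical_set_scope.

Section Tuples.
Variable V : zmodType.

Definition tupd l (v : l.-tuple V) (i : 'I_l) (x : V) : l.-tuple V :=
  [tuple if j == i then x else tnth v j | j < l].

Definition tjoin r m (h : (r <= m)%N) (v : r.-tuple V) (u : (m - r).-tuple V) :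
  m.-tuple V := tcast (subnKC h) [tuple of v ++ u].

Lemma val_tjoin r m (h : (r <= m)%N) (v : r.-tuple V) (u : (m - r).-tuple V) :
  tjoin h v u = v ++ u :> seq V.
Proof. by rewrite /tjoin val_tcast. Qed.

Lemma nth_tupd l (v : l.-tuple V) (i : 'I_l) x k :
  (tupd v i x)`_k = if k == i then x else v`_k.
Proof.
case: (ltnP k l) => hk; last first.
  rewrite !nth_default ?size_tuple //; case: eqP => // e.
  by move: hk; rewrite e leqNgt ltn_ord.
by rewrite -[k]/(nat_of_ord (Ordinal hk)) -tnth_nth tnth_mktuple (tnth_nth 0).
Qed.

Lemma eq_tuple_nth l (u v : l.-tuple V) :
  (forall k, (k < l)%N -> u`_k = v`_k) -> u = v.
Proof.
move=> h; apply/val_inj/(@eq_from_nth _ 0); first by rewrite !size_tuple.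
by move=> k; rewrite size_tuple; apply: h.
Qed.

Lemma tjoin_updl r m (h : (r <= m)%N) (v : r.-tuple V) (u : (m - r).-tuple V)
    (i : 'I_r) x :
  tjoin h (tupd v i x) u = tupd (tjoin h v u) (widen_ord h i) x.
Proof.
apply: eq_tuple_nth => k hk.
rewrite nth_tupd !val_tjoin !nth_cat !size_tuple nth_tupd /=.
by case: ltnP => // hr; case: eqP => // e; move: hr; rewrite e leqNgt ltn_ord.
Qed.

Lemma tjoin_updr r m (h : (r <= m)%N) (v : r.-tuple V) (u : (m - r).-tuple V)
    (i : 'I_(m - r)) x :
  tjoin h v (tupd u i x)
  = tupd (tjoin h v u) (cast_ord (subnKC h) (rshift r i)) x.
Proof.
apply: eq_tuple_nth => k hk.
rewrite nth_tupd !val_tjoin !nth_cat !size_tuple nth_tupd /=.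
case: ltnP => hr.
  by case: eqP => // e; move: hr; rewrite e ltnNge leq_addr.
by rewrite -(eqn_add2l r) subnKC.
Qed.

End Tuples.

Section ExteriorForms.
Variables (R : realType) (V : vectType R).

Definition multilinear_map l (f : l.-tuple V -> R^o) : Prop :=
  forall v i, linear (fun x : V => f (tupd v i x)).

Definition alternating_map l (f : l.-tuple V -> R^o) : Prop :=
  forall v : l.-tuple V, ~~ uniq v -> f v = 0.

Definition is_extform l : {pred (l.-tuple V -> R^o)} :=
  fun f => `[< multilinear_map f /\ alternating_map f >].

Fact is_extform_submod l : submod_closed (@is_extform l).
Proof.
split.
  apply/asboolP; split=> [v i a x y|v _] //=.
  by rewrite scaler0 addr0.
move=> a f g /asboolP[fm fa] /asboolP[gm ga]; apply/asboolP; split.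
  move=> v i b x y; rewrite !fctE fm gm !scalerDr !scalerA [b * a]mulrC.
  by rewrite addrACA.
by move=> v hv; rewrite !fctE fa// ga// scaler0 addr0.
Qed.

HB.instance Definition _ l :=
  GRing.isSubmodClosed.Build R (l.-tuple V -> R^o) (@is_extform l)
    (is_extform_submod l).

Record extform l := ExtForm {
  extform_fun :> l.-tuple V -> R^o;
  extformP : extform_fun \in @is_extform l }.

HB.instance Definition _ l := [isSub for @extform_fun l].
HB.instance Definition _ l := [Choice of extform l by <:].
HB.instance Definition _ l := [SubChoice_isSubLmodule of extform l by <:].

(* In finite dimension, the l-th exterior power of V is canonically the dual of
   the space of exterior l-forms on V; it is realised here as this dual, with
   v_1 /\ ... /\ v_l acting by evaluation at (v_1, ..., v_l). *)
Definition is_multivector l : {pred (extform l -> R^o)} :=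
  fun X => `[< linear X >].

Fact is_multivector_submod l : submod_closed (@is_multivector l).
Proof.
split; first by apply/asboolP => a f g /=; rewrite scaler0 addr0.
move=> a X Y /asboolP hX /asboolP hY; apply/asboolP => b f g.
rewrite !fctE hX hY !scalerDr !scalerA [b * a]mulrC.
by rewrite addrACA.
Qed.

HB.instance Definition _ l :=
  GRing.isSubmodClosed.Build R (extform l -> R^o) (@is_multivector l)
    (is_multivector_submod l).

Record multivector l := Multivector {
  multivector_fun :> extform l -> R^o;
  multivectorP : multivector_fun \in @is_multivector l }.

HB.instance Definition _ l := [isSub for @multivector_fun l].
HB.instance Definition _ l := [Choice of multivector l by <:].
HB.instance Definition _ l := [SubChoice_isSubLmodule of multivector l by <:].

Fact wedge_subproof l (v : l.-tuple V) :
  (fun f : extform l => f v) \in @is_multivector l.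
Proof. by apply/asboolP => a f g. Qed.

Definition wedge l (v : l.-tuple V) : multivector l :=
  Multivector (wedge_subproof v).

Fact slice_subproof r m (h : (r <= m)%N) (f : extform m)
    (u : (m - r).-tuple V) :
  (fun v : r.-tuple V => f (tjoin h v u)) \in @is_extform r.
Proof.
have /asboolP[fm fa] := extformP f; apply/asboolP; split=> [v i a x y|v hv].
  by rewrite !tjoin_updl fm.
by apply: fa; rewrite val_tjoin cat_uniq negb_and hv.
Qed.

Definition slice r m (h : (r <= m)%N) (f : extform m) (u : (m - r).-tuple V) :
  extform r := ExtForm (slice_subproof h f u).

Fact contract_subproof r m (h : (r <= m)%N) (X : multivector r)
    (f : extform m) :
  (fun u : (m - r).-tuple V => X (slice h f u)) \in @is_extform (m - r).
Proof.
have /asboolP[fm fa] := extformP f; have /asboolP XL := multivectorP X.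
apply/asboolP; split=> [u i a x y|u hu].
  rewrite -XL; congr (multivector_fun X _); apply/val_inj/funext => v /=.
  by rewrite tjoin_updr fm -!tjoin_updr.
have -> : slice h f u = 0.
  apply/val_inj/funext => v /=; apply: fa.
  by rewrite val_tjoin cat_uniq !negb_and hu !orbT.
by have := XL (-1) 0 0; rewrite scaler0 addr0 scaleN1r addNr.
Qed.

(* Contraction by a decomposable multivector inserts its factors in the first
   slots of the form, see contract_wedge. When r > m the contraction is 0. *)
Definition contract r m (X : multivector r) (f : extform m) : extform (m - r) :=
  if pselect (r <= m)%N is left h then ExtForm (contract_subproof h X f)
  else 0.

Lemma contract_wedge r m (h : (r <= m)%N) (v : r.-tuple V) (f : extform m)
    (u : (m - r).-tuple V) :
  contract (wedge v) f u = f (tjoin h v u).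
Proof.
rewrite /contract; case: pselect => [h'|//].
by rewrite /= (bool_irrelevance h' h).
Qed.

Lemma contract_gt r m (X : multivector r) (f : extform m) :
  (m < r)%N -> contract X f = 0.
Proof.
by move=> mr; rewrite /contract; case: pselect => // h; rewrite ltnNge h in mr.
Qed.

Definition decomposable l (W : {vspace V}) : set (multivector l) :=
  [set wedge v | v in [set v : l.-tuple V | {subset v <= W}]].

Definition multisymplectic k (omega : extform k.+1) : Prop :=
  (1 <= k)%N /\
  forall v : V, contract (wedge [tuple v]) omega = 0 <-> v = 0.

Definition rnondegenerate r m (omega : extform m) : Prop :=
  forall X : multivector r, decomposable fullv X ->
    (contract X omega = 0 <-> X = 0).

Definition perpII l m (omega : extform m) (W : {vspace V}) :
    set (multivector l) :=
  [set wedge v | v in [set v : l.-tuple V |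
     forall w, w \in W -> contract (wedge [tuple of rcons v w]) omega = 0]].

(* The complement perpII l W is only considered for 1 <= l <= dim V, hence so
   are the two notions below. This matters for V = 0, where every form of
   positive degree is 0 and multisymplectic. *)
Definition isotropicII l m (omega : extform m) (W : {vspace V}) : Prop :=
  (1 <= l <= \dim (fullv : {vspace V}))%N /\
  decomposable W `<=` @perpII l m omega W.

Definition lagrangianII l m (omega : extform m) (W : {vspace V}) : Prop :=
  (1 <= l <= \dim (fullv : {vspace V}))%N /\
  decomposable W = @perpII l m omega W.

Definition codimv (W : {vspace V}) : nat := (\dim {:V} - \dim W)%N.

End ExteriorForms.

Arguments extform {R} V l.
Arguments multivector {R} V l.
Arguments decomposable {R V} l W.
Arguments rnondegenerate {R V} r {m} omega.
Arguments perpII {R V} l {m} omega W.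
Arguments isotropicII {R V} l {m} omega W.
Arguments lagrangianII {R V} l {m} omega W.

(* Main.v *)
Require Import Defs.
From HB Require Import structures.
From mathcomp Require Import all_boot all_order all_algebra.
From mathcomp Require Import all_classical all_reals.
Set Implicit Arguments.
Unset Strict Implicit.
Unset Printing Implicit Defensive.
Import Order.TTheory GRing.Theory Num.Theory.
Local Open Scope ring_scope.
Local Open Scope classical_set_scope.

(** The three parts all come from one dimension count, [vanishes_dim]: if a
nonzero alternating form [f] of degree [m] vanishes as soon as one of its
arguments lies in a subspace [W], then [m + \dim W <= \dim V].  Indeed, pick [v]
with [f v != 0].  Putting a linear combination of the [v_j] in slot [i] of [f v]
multiplies the value by its [i]-th coefficient, because the other terms repeat a
vector; so no combination of the [v_j] lies in [W] except the trivial one, that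
is, [v] is free and its span meets [W] only in [0].
For [W = 0] this says that forms vanish on dependent vectors.

Part (1): [l] vectors of a space [W] of dimension [l], and one more vector of
[W], are dependent, so the contraction is [0].

Part (2): if [\dim W < r], use that [omega] is nonzero, hence
[k + 1 <= \dim V].  Otherwise choose [r] independent vectors of [W].  Their wedge
is nonzero, so by nondegeneracy its contraction with [omega] is a nonzero form
of degree [k + 1 - r]; isotropy says that this form vanishes on [W], and
[vanishes_dim] concludes.  That the wedge of a free family is nonzero means that
some form does not vanish on it: the determinant of coordinates does not.

Part (3): when [omega] has top degree, its contraction with a free family is
never [0] ([top_contract_neq0]).  So if [v_1, ..., v_l] is free and its wedge is
in the complement of [W], no [w] in [W] can be added to it while keeping it
free: [W] is contained in the span of the [v_i].  If [l = \dim W] then the span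
is [W]; if [l < \dim W] this is impossible, and only the zero multivector is
left. *)

(* The short name also denotes the contraction of the extended real line onto
   the interval [-1, 1]. *)
Local Notation contraction := Defs.contract.

(** * Alternating forms vanishing on a subspace *)

Section AlternatingForms.
Variables (R : realType) (V : vectType R).

Lemma dim_free_tuple l (v : l.-tuple V) : free v -> \dim <<v>> = l.
Proof. by move=> /eqP ->; rewrite size_tuple. Qed.

Lemma extform_neq0 m (f : extform V m) : f != 0 -> exists v, f v != 0.
Proof.
move=> f0; apply: contrapT => h; case/eqP: f0.
apply/val_inj/funext => v /=; apply/eqP; apply: contrapT => /negP fv.
by apply: h; exists v.
Qed.

Lemma extform_notuniq m (f : extform V m) (v : m.-tuple V) :
  ~~ uniq v -> f v = 0.
Proof. by have /asboolP[_] := extformP f; apply. Qed.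

(** Named so that it can carry the structure of a linear map in the new vector. *)
Definition slot m (f : extform V m) (v : m.-tuple V) (i : 'I_m) : V -> R^o :=
  fun x => f (tupd v i x).

Fact slot_linear m (f : extform V m) (v : m.-tuple V) (i : 'I_m) :
  linear (slot f v i).
Proof. by have /asboolP[fm _] := extformP f; apply: fm. Qed.

HB.instance Definition _ m (f : extform V m) (v : m.-tuple V) (i : 'I_m) :=
  GRing.isLinear.Build R V R^o _ (slot f v i) (slot_linear f v i).

Lemma tupd_id m (v : m.-tuple V) (i : 'I_m) : tupd v i v`_i = v.
Proof.
by apply: eq_tuple_nth => k _; rewrite nth_tupd; case: eqP => // ->.
Qed.

Lemma tupdC m (v : m.-tuple V) (i j : 'I_m) x y : i != j ->
  tupd (tupd v i x) j y = tupd (tupd v j y) i x.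
Proof.
move=> ij; apply: eq_tuple_nth => k _; rewrite !nth_tupd.
by case: (eqVneq k j) => [->|//]; rewrite eq_sym (negPf (ij : i != j :> nat)).
Qed.

Lemma tupd_head m (v : m.-tuple V) (m0 : (0 < m)%N) x :
  tupd v (Ordinal m0) x = x :: behead v :> seq V.
Proof.
apply: (@eq_from_nth _ 0) => [|k _].
  by rewrite size_tuple /= size_behead size_tuple prednK.
by rewrite nth_tupd; case: k => //= k; rewrite nth_behead.
Qed.

Lemma repeat_notuniq m (v : m.-tuple V) (i j : 'I_m) :
  i != j -> v`_i = v`_j -> ~~ uniq v.
Proof.
move=> ij e; apply/negP => /(uniqP 0) /(_ i j).
by rewrite !inE size_tuple !ltn_ord => /(_ isT isT e) /val_inj /eqP; apply/negP.
Qed.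

(** Polarisation: the value with [x + y] in both slots is [0], and so are the
values with [x] twice and with [y] twice. *)
Lemma slot_swap m (f : extform V m) (v : m.-tuple V) (i j : 'I_m) x y :
  i != j ->
  slot f (tupd v i x) j y = - slot f (tupd v i y) j x.
Proof.
move=> ij; apply/eqP; rewrite -addr_eq0; apply/eqP.
have diag z : slot f (tupd v i z) j z = 0.
  apply/extform_notuniq/(repeat_notuniq ij).
  by rewrite !nth_tupd eqxx (negPf (ij : i != j :> nat)) eqxx.
have slotC z t : slot f (tupd v i z) j t = slot f (tupd v j t) i z.
  by rewrite /slot tupdC.
have := diag (x + y).
rewrite linearD /= !(slotC (x + y)) !linearD /= -!slotC !diag.
by rewrite add0r addr0 addrC.
Qed.

(** A condition on one slot only, because a contraction with the vectors of a
family followed by [w] gives control on the first slot of a form only. *)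
Definition vanishes_at m (f : extform V m) (i : 'I_m) (W : {vspace V}) :=
  forall v w, w \in W -> slot f v i w = 0.

(** Antisymmetry brings the vector of slot [j] into slot [i]. *)
Lemma vanishes_everywhere m (f : extform V m) (i : 'I_m) j W :
  vanishes_at f i W -> vanishes_at f j W.
Proof.
move=> fW v w wW; have [<-|ij] := eqVneq i j; first exact: fW.
have -> : slot f v j w = slot f (tupd v i v`_i) j w by rewrite tupd_id.
rewrite slot_swap // /slot tupdC // -/(slot f _ i w).
by rewrite fW ?oppr0.
Qed.

(** Every term with [j != i] repeats the vector [v_j]. *)
Lemma slot_lincomb m (f : extform V m) (v : m.-tuple V) (i : 'I_m)
    (a : 'I_m -> R) :
  slot f v i (\sum_j a j *: v`_j) = a i * f v.
Proof.
rewrite linear_sum (bigD1 i) //= linearZ /= {1}/slot tupd_id.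
rewrite big1 ?addr0 // => j ji; rewrite linearZ /= {1}/slot.
rewrite extform_notuniq ?scaler0 //; apply: (repeat_notuniq ji).
by rewrite !nth_tupd eqxx; case: ifP.
Qed.

Lemma lincomb_eq0 m (f : extform V m) (i : 'I_m) W v (a : 'I_m -> R) :
    vanishes_at f i W -> f v != 0 -> \sum_j a j *: v`_j \in W ->
  forall j, a j = 0.
Proof.
move=> fW fv aW j; apply/eqP; have := vanishes_everywhere j fW v aW.
by rewrite slot_lincomb => /eqP; rewrite mulf_eq0 (negPf fv) orbF.
Qed.

Lemma vanishes_at0 m (f : extform V m) (i : 'I_m) : vanishes_at f i 0%VS.
Proof. by move=> v w; rewrite memv0 => /eqP ->; rewrite linear0. Qed.

Lemma extform_free m (f : extform V m) (v : m.-tuple V) : f v != 0 -> free v.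
Proof.
move=> fv; apply/freeP => a a0 i.
by apply: (lincomb_eq0 (@vanishes_at0 _ f i) fv); rewrite a0 mem0v.
Qed.

(** A family on which [f] does not vanish is free, and by [lincomb_eq0] its span
is in direct sum with [W]. *)
Lemma vanishes_dim m (f : extform V m) (i : 'I_m) W :
  f != 0 -> vanishes_at f i W -> (m + \dim W <= \dim {:V})%N.
Proof.
move=> /extform_neq0[v fv] fW.
have vW : (<<v>> :&: W = 0)%VS.
  apply/eqP; rewrite -subv0; apply/subvP => x.
  rewrite memv_cap => /andP[/coord_span xv]; rewrite xv => xW.
  rewrite big1 ?mem0v // => j _; rewrite (_ : coord v j x = 0) ?scale0r //.
  exact: (lincomb_eq0 fW fv xW j).
rewrite -[X in (X + _)%N](dim_free_tuple (extform_free fv)).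
by rewrite -(dimv_disjoint_sum vW) dimvS ?subvf.
Qed.

Lemma extform_deg m (f : extform V m) : f != 0 -> (m <= \dim {:V})%N.
Proof.
move=> /extform_neq0[v /extform_free/dim_free_tuple vm].
by rewrite -[X in (X <= _)%N]vm dimvS ?subvf.
Qed.

(** * Wedges and linear independence *)

Lemma wedge_neq0_free m (v : m.-tuple V) : wedge v != 0 -> free v.
Proof.
move=> v0; apply: contrapT => nv; case/eqP: v0.
apply/val_inj/funext => f /=; apply/eqP.
by case: eqVneq => // /extform_free.
Qed.

(** A form that takes the value [1] on a given free family: the determinant of
the coordinates with respect to that family.  It separates the wedge of the
family from [0]. *)
Section Determinant.
Variables (m : nat) (e : m.-tuple V).

Let coord_mx (v : m.-tuple V) := \matrix_(i < m, j < m) coord e j v`_i.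

Fact coord_det_subproof :
  (fun v : m.-tuple V => \det (coord_mx v) : R^o) \in @is_extform R V m.
Proof.
apply/asboolP; split=> [v i a x y|v].
  (* Only row [i] depends on the vector put in slot [i]. *)
  have off z : row' i (coord_mx (tupd v i z)) = row' i (coord_mx v).
    apply/matrixP => p q; rewrite !mxE !nth_tupd eq_sym.
    by rewrite (negPf (neq_lift i p : _ != _ :> nat)).
  rewrite [LHS](@determinant_multilinear _ _ _ (coord_mx (tupd v i x))
    (coord_mx (tupd v i y)) i a 1) ?off ?mul1r //.
  by apply/rowP => j; rewrite !mxE !nth_tupd eqxx linearP /= mul1r.
move=> /(uniqPn 0)[i [j [ij]]]; rewrite size_tuple => jm vij.
have im := ltn_trans ij jm.
apply: (@determinant_alternate _ _ _ (Ordinal im) (Ordinal jm)) => [|q].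
  by rewrite -val_eqE /= ltn_eqF.
by rewrite !mxE /= vij.
Qed.

Definition coord_det : extform V m := ExtForm coord_det_subproof.

Lemma coord_det1 : free e -> coord_det e = 1.
Proof.
move=> fe; rewrite /coord_det /= -[RHS](det1 _ m); congr (\det _).
by apply/matrixP => i j; rewrite !mxE coord_free // -val_eqE.
Qed.

Lemma free_wedge_neq0 : free e -> wedge e != 0.
Proof.
move=> fe; apply/eqP => e0; have /eqP := coord_det1 fe.
by rewrite -[coord_det e]/(wedge e coord_det) e0 eq_sym oner_eq0.
Qed.

End Determinant.

(** * Contraction with a decomposable multivector *)

Lemma contract_notfree r m (f : extform V m) (v : r.-tuple V) :
  ~~ free v -> contraction (wedge v) f = 0.
Proof.
move=> nv; have [rm|] := leqP r m; last exact: contract_gt.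
apply/val_inj/funext => u /=; rewrite contract_wedge.
apply: contrapT => /eqP /extform_free; rewrite val_tjoin => /catl_free vf.
by rewrite vf in nv.
Qed.

(** The first slot of the contraction with [v] is slot [r] of [f], the one filled
by [w] in the contraction with [rcons v w]. *)
Lemma contract_rcons r m (rm : (0 < m - r)%N) (f : extform V m)
    (v : r.-tuple V) w : contraction (wedge [tuple of rcons v w]) f = 0 ->
  forall u, slot (contraction (wedge v) f) u (Ordinal rm) w = 0.
Proof.
move=> fvw u; have h : (r < m)%N by rewrite -subn_gt0.
have e : (m - r).-1 = (m - r.+1)%N by rewrite subnS.
have := congr1 (fun g : extform V _ => g (tcast e [tuple of behead u])) fvw.
rewrite contract_wedge /slot (contract_wedge (ltnW h)) => fu0.
rewrite -[RHS]fu0; congr (f _); apply: eq_tuple_nth => k _.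
by rewrite !val_tjoin tupd_head val_tcast /= cat_rcons.
Qed.

Lemma perp_vanishes r m (rm : (0 < m - r)%N) (f : extform V m)
    (v : r.-tuple V) (W : {vspace V}) :
  (forall w, w \in W -> contraction (wedge [tuple of rcons v w]) f = 0) ->
  vanishes_at (contraction (wedge v) f) (Ordinal rm) W.
Proof. by move=> h u w /h /contract_rcons; apply. Qed.

(** In top degree, linear independence suffices for a nonzero contraction.  By
induction on the family [rcons p x]: the form [p] contracted with [f] is nonzero
of degree [m - r] and vanishes on [p].  Were the contraction with [rcons p x]
zero, it would also vanish on [x], hence on a space of dimension [r + 1], too
large for [vanishes_dim]. *)
Lemma top_contract_neq0 m (f : extform V m) : f != 0 -> m = \dim {:V} ->
  forall r (v : r.-tuple V), free v -> contraction (wedge v) f != 0.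
Proof.
move=> f0 mV; elim=> [|r IH] v.
  move=> _; have [u fu] := extform_neq0 f0.
  apply/eqP => /(congr1 (fun g : extform V _ => g (tcast (esym (subn0 m)) u))).
  rewrite (contract_wedge (leq0n m)) /=; apply/eqP.
  suff -> : tjoin (leq0n m) v (tcast (esym (subn0 m)) u) = u by [].
  by apply: eq_tuple_nth => k _; rewrite val_tjoin val_tcast (tuple0 v).
case/tupleP: v => x0 v0.
pose p := [tuple of belast x0 v0]; pose x := last x0 v0.
have -> : [tuple of x0 :: v0] = [tuple of rcons p x].
  by apply: val_inj; rewrite /= lastI.
set q := [tuple of rcons p x] => qf.
have pf : free p by move: qf; rewrite /= -cats1 => /catl_free.
apply/eqP => q0.
have dimq : \dim <<q>> = r.+1 by apply: dim_free_tuple.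
have rm : (0 < m - r)%N by rewrite subn_gt0 mV -dimq dimvS ?subvf.
(* On [p] the contraction vanishes by repetition, on [x] by [q0]. *)
have qW : vanishes_at (contraction (wedge p) f) (Ordinal rm) <<q>>.
  suff qi0 (i : 'I_r.+1) : contraction (wedge [tuple of rcons p q`_i]) f = 0.
    move=> u w /coord_span ->; rewrite linear_sum big1 // => i _.
    by rewrite linearZ /= (contract_rcons rm (qi0 i)) scaler0.
  have [ir|ri] := ltnP i r.
    apply: contract_notfree; apply/negP => /free_uniq.
    by rewrite rcons_uniq nth_rcons size_tuple ir mem_nth ?size_tuple.
  suff -> : q`_i = x by [].
  have /eqP ir : i == r :> nat by rewrite eqn_leq ri -ltnS ltn_ord.
  by rewrite nth_rcons size_tuple ir ltnn eqxx.
have := vanishes_dim (IH _ pf) qW.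
by rewrite dimq -mV addnS subnK ?ltnn // ltnW // -subn_gt0.
Qed.

(** The zero form would annihilate every vector, so its kernel would be [V]. *)
Lemma multisymplectic_neq0 k (omega : extform V k.+1) :
  multisymplectic omega -> (0 < \dim {:V})%N -> omega != 0.
Proof.
move=> [_ h] V0; apply/eqP => o0; move: V0; rewrite lt0n dimv_eq0; case/negP.
rewrite -subv0; apply/subvP => v _; rewrite memv0; apply/eqP/h.
by apply/val_inj/funext => u /=; rewrite (contract_wedge (ltn0Sn k)) o0.
Qed.

(** * Orthogonal complements of the second type *)

Lemma mem0_notfree (s : seq V) : 0 \in s -> ~~ free s.
Proof. by move=> s0; apply/negP => /free_not0 /(_ s0); rewrite eqxx. Qed.

Lemma wedge_nseq0 l : (0 < l)%N -> wedge [tuple of nseq l (0 : V)] = 0.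
Proof.
move=> l0; apply/eqP; apply: contraT => /wedge_neq0_free.
by rewrite (negPf (mem0_notfree _)) // mem_nseq l0 eqxx.
Qed.

Lemma wedge0_in_perp l m (f : extform V m) (W : {vspace V}) :
  (0 < l)%N -> perpII l f W 0.
Proof.
move=> l0; exists [tuple of nseq l 0]; last exact: wedge_nseq0.
move=> w _; apply/contract_notfree/mem0_notfree.
by rewrite mem_rcons inE mem_nseq l0 eqxx orbT.
Qed.

Lemma wedge0_decomposable l (W : {vspace V}) :
  (0 < l)%N -> decomposable l W 0.
Proof.
move=> l0; exists [tuple of nseq l 0]; last exact: wedge_nseq0.
by move=> x /nseqP[-> _]; exact: mem0v.
Qed.

(** With [w], the family has [l + 1] vectors in a space of dimension at most
[l], so it is dependent. *)
Lemma decomposable_perp l m (f : extform V m) (W : {vspace V}) :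
  (\dim W <= l)%N -> decomposable l W `<=` perpII l f W.
Proof.
move=> Wl _ [v vW <-]; exists v => // w wW; apply: contract_notfree.
apply/negP => /dim_free_tuple vw.
suff : (l.+1 <= l)%N by rewrite ltnn.
rewrite -[X in (X <= _)%N]vw; apply: leq_trans Wl; apply/dimvS/span_subvP => x.
by rewrite mem_rcons inE => /predU1P[->|/vW].
Qed.

(** A vector [w] of [W] outside the span of [v] would make [rcons v w] free,
with a nonzero contraction by [top_contract_neq0]. *)
Lemma top_perp_span l m (f : extform V m) (W : {vspace V}) (v : l.-tuple V) :
    f != 0 -> m = \dim {:V} -> free v ->
    (forall w, w \in W -> contraction (wedge [tuple of rcons v w]) f = 0) ->
  (W <= <<v>>)%VS.
Proof.
move=> f0 mV vf vW; apply/subvP => w wW; apply: contraT => wv.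
have qf : free [tuple of rcons v w].
  have /perm_free -> : perm_eq [tuple of rcons v w] (w :: v).
    by rewrite /= perm_rcons.
  by rewrite free_cons wv.
by have := top_contract_neq0 f0 mV qf; rewrite vW ?eqxx.
Qed.

End AlternatingForms.

Theorem proposition3p4 (R : realType) (V : vectType R) (n k : nat)
    (omega : extform V k.+1) (hn : \dim {:V} = n)
    (homega : multisymplectic omega) :
  [/\ forall (l : nat) (W : {vspace V}), (1 <= l <= n)%N -> \dim W = l ->
        isotropicII l omega W,
      forall (r : nat) (W : {vspace V}), (1 <= r <= k)%N ->
        rnondegenerate r omega -> isotropicII r omega W ->
        (k + 1 - r <= codimv W)%N
    & k.+1 = n -> forall W : {vspace V}, W != 0%VS ->
        lagrangianII (\dim W) omega W /\
        forall l' : nat, (1 <= l' < \dim W)%N ->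
          perpII l' omega W = [set 0]].
Proof.
split.
- move=> l W /andP[l0 ln] Wl; split; first by rewrite hn l0 ln.
  by apply: decomposable_perp; rewrite Wl.
- move=> r W /andP[r0 rk] onr [/andP[_ rV] Wiso].
  have o0 := multisymplectic_neq0 homega (leq_trans r0 rV).
  rewrite /codimv addn1 leq_subRL ?dimvS ?subvf //.
  have [rW|Wr] := leqP r (\dim W); last first.
    apply: leq_trans (extform_deg o0).
    rewrite -[X in (_ <= X)%N](subnKC (leq_trans rk (leqnSn k))).
    by rewrite leq_add2r ltnW.
  have vsz : size (take r (vbasis W)) == r by rewrite size_takel ?size_tuple.
  pose v := Tuple vsz.
  have vf : free v.
    have := basis_free (vbasisP W).
    by rewrite -(cat_take_drop r (vbasis W)) => /catl_free.
  have vW : {subset v <= W} by move=> x /mem_take /vbasis_mem.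
  (* The complement only provides some representative [v'] of the multivector;
     contraction depends on the multivector alone, so [v'] serves as well. *)
  have [v' v'W vv'] : perpII r omega W (wedge v) by apply: Wiso; exists v.
  have c0 : contraction (wedge v') omega != 0.
    rewrite vv'; apply/eqP => /(onr _ _).1 h.
    have : wedge v = 0 by apply: h; exists v => // x _; apply: memvf.
    by apply/eqP/free_wedge_neq0.
  have rm : (0 < k.+1 - r)%N by rewrite subn_gt0 ltnS.
  by have := vanishes_dim c0 (perp_vanishes rm v'W); rewrite addnC.
- move=> kn W W0; have WV : (\dim W <= \dim {:V})%N by rewrite dimvS ?subvf.
  have W1 : (0 < \dim W)%N by rewrite lt0n dimv_eq0.
  have o0 := multisymplectic_neq0 homega (leq_trans W1 WV).
  have top : k.+1 = \dim {:V} by rewrite hn.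
  split.
    split; first by rewrite W1 WV.
    apply/seteqP; split; first exact: decomposable_perp.
    move=> _ [v vW <-].
    have [->|/wedge_neq0_free vf] := eqVneq (wedge v) 0.
      exact: wedge0_decomposable.
    exists v => // x xv; have /eqP -> : W == <<v>>%VS.
      by rewrite eqEdim (top_perp_span o0 top vf vW) (dim_free_tuple vf) /=.
    exact: memv_span.
  move=> l /andP[l0 lW]; apply/seteqP; split=> [_ [v vW <-]|_ ->]; last first.
    exact: wedge0_in_perp.
  apply/eqP; apply: contraT => /wedge_neq0_free vf.
  have /dimvS := top_perp_span o0 top vf vW.
  by rewrite (dim_free_tuple vf) leqNgt lW.
Qed.
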